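(* Let $n$ be a positive odd integer and $d\geq3$ an integer with $n\equiv 1\pmod d$. For integers $k\geq0$ define $$c_q(k)=(-1)^k\frac{(1+q^{2dk+1})(q^2;q^{2d})^2_k}{(1+q)(q^{2d};q^{2d})^2_k}q^{dk^2+(d-1)k}.$$ Then, modulo $\Phi_n(-q)^2\Phi_n(q)^2$, $$\sum_{\substack{i,j,s\geq0\\ i+j+s\leq n-1}}c_q(i)c_q(j)c_q(s)\equiv(-1)^{\frac{3(n-1)}{d}}[n]^3_{q^2}q^{\frac{3(n-1)(n+1-d)}{d}}\bigg(\sum_{k=0}^{\frac{n-1}{d}}\frac{(q^2,q;q^{2d})_k\, q^{2(d-1)k}}{(q^{2d},q^{2d+1};q^{2d})_k}\bigg)^3.$$
   Context: Here $q$ is an indeterminate. The $q$-shifted factorial is $(a;q)_0=1$, $(a;q)_m=(1-a)(1-aq)\cdots(1-aq^{m-1})$ for $m\geq1$, and $(a_1,\dots,a_s;q)_m=(a_1;q)_m\cdots(a_s;q)_m$. $[m]_{q^2}=1+q^2+\cdots+q^{2(m-1)}$. $\Phi_n(q)$ denotes the $n$-th cyclotomic polynomial in $q$. A congruence between rational functions in $q$ modulo a polynomial $P(q)$ means that the numerator of the difference (in reduced form) is divisible by $P(q)$ while its denominator is coprime to $P(q)$. *)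

(* Defs.v *)
From mathcomp Require Import all_boot all_order all_algebra all_field.

Set Implicit Arguments.
Unset Strict Implicit.
Unset Printing Implicit Defensive.

Import GRing.Theory.
Local Open Scope ring_scope.

Notation ratfun := {fraction {poly rat}}.

Definition qvar : ratfun := FracField.tofrac 'X.

Definition qpoch (R : comNzRingType) (a q : R) (m : nat) : R :=
  \prod_(i < m) (1 - a * q ^+ i).

Definition qpochs (R : comNzRingType) (s : seq R) (q : R) (m : nat) : R :=
  \prod_(a <- s) qpoch a q m.

Definition qint (R : comNzRingType) (q : R) (m : nat) : R :=
  \sum_(i < m) q ^+ i.

Definition Phi (n : nat) : {poly rat} := map_poly intr 'Phi_n.

(* The fraction num / den is in reduced form; it is unique up to a common
   nonzero constant factor, so the choice of num and den does not matter. *)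
Definition qcongr (P : {poly rat}) (x y : ratfun) : Prop :=
  exists num den : {poly rat},
    [/\ den != 0,
        coprimep num den,
        x - y = FracField.tofrac num / FracField.tofrac den,
        P %| num
      & coprimep den P].

Definition c_q (d k : nat) : ratfun :=
  let q := qvar in
  (-1) ^+ k
  * ((1 + q ^+ (2 * d * k + 1)) * qpoch (q ^+ 2) (q ^+ (2 * d)) k ^+ 2
     / ((1 + q) * qpoch (q ^+ (2 * d)) (q ^+ (2 * d)) k ^+ 2))
  * q ^+ (d * k ^ 2 + (d - 1) * k).

(* Main.v *)
Require Import Defs.
From mathcomp Require Import all_boot all_order all_algebra all_field.
From mathcomp Require Import ring zify.
Import GRing.Theory.
Local Open Scope ring_scope.

(** Put b = q, a = q^2, p = q^(2d), m = (n-1)/d and Q = q^(2n) = a p^m.  For odd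
    n the product Phi_n(q) Phi_n(-q) divides 1 - Q, so it suffices to work
    modulo (1 - Q)^2 among rational functions regular at Phi_n(q) Phi_n(-q).
    For m < k < n the factor (1 - Q)^2 of (q^2;p)_k^2 kills c_q(k); since
    3m <= n-1, the triple sum is congruent to the cube of the sum of the c_q(k)
    over k <= m.  As (1 - yQ)(1 - y/Q) - (1 - y)^2 = - y (1 - Q)^2 / Q, every
    factor (1 - y)^2 of c_q(k) may be deformed into (1 - yQ)(1 - y/Q).  The
    deformed sum is the left-hand side of Watson's 8phi7 -> 4phi3
    transformation (with parameters p, b, infinity, aQ and p^-m), and undoing
    the deformation on the other side gives the cube root of the claimed
    right-hand side.  The pole of that 4phi3 at Phi_n(q), present when m is
    even, is compensated by the factor [n]. *)

(** * A limiting case of Watson's transformation *)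

Lemma qpoch0 (R : comNzRingType) (a q : R) : qpoch a q 0 = 1.
Proof. by rewrite /qpoch big_ord0. Qed.

Lemma qpochS (R : comNzRingType) (a q : R) (m : nat) :
  qpoch a q m.+1 = qpoch a q m * (1 - a * q ^+ m).
Proof. by rewrite /qpoch big_ord_recr. Qed.

Lemma qpochSl (R : comNzRingType) (a q : R) (m : nat) :
  qpoch a q m.+1 = (1 - a) * qpoch (a * q) q m.
Proof.
rewrite /qpoch big_ord_recl expr0 mulr1; congr (_ * _).
by apply: eq_bigr => i _; rewrite lift0 exprS mulrA.
Qed.

Lemma qpochD (R : comNzRingType) (a q : R) (m k : nat) :
  qpoch a q (m + k) = qpoch a q m * qpoch (a * q ^+ m) q k.
Proof.
elim: k => [|k IH]; first by rewrite addn0 qpoch0 mulr1.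
by rewrite addnS !qpochS IH exprD !mulrA.
Qed.

Lemma qpoch_neq0 (F : fieldType) (a q : F) (m : nat) :
  (forall i, (i < m)%N -> 1 - a * q ^+ i != 0) -> qpoch a q m != 0.
Proof. by move=> h; apply/prodf_neq0 => i _; apply: h. Qed.

(** For nonzero [x] this is x^k (1/x;p)_k / (a x p;p)_k, the contribution of the parameter 1/x to a
    well-poised series; [x = p ^+ n] makes the series terminate. *)
Definition wp_factor (F : fieldType) (a p x : F) (k : nat) : F :=
  \prod_(i < k) ((x - p ^+ i) / (1 - a * x * p ^+ i.+1)).

(** Up to the constant factor 1 - a, the term of a very-well-poised 6phi5 in base p with parameters
    1/x, 1/z and a third one sent to infinity. *)
Definition wp_term (F : fieldType) (a p x z : F) (k : nat) : F :=
  (-1) ^+ k * a ^+ k * p ^+ 'C(k.+1, 2) * (1 - a * p ^+ (2 * k))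
  * qpoch a p k / qpoch p p k * (wp_factor F a p x k * wp_factor F a p z k).

(* Up to sign and powers of [p] this is a Newton basis polynomial of degree [j]
   in the variable [a * p ^+ k + p ^- k]. *)
Definition newton (F : fieldType) (a p : F) (k j : nat) : F :=
  qpoch (a * p ^+ k) p j * qpoch (p ^- k) p j.

Lemma wp_factorS (F : fieldType) (a p x : F) (k : nat) :
  wp_factor F a p x k.+1
  = wp_factor F a p x k * ((x - p ^+ k) / (1 - a * x * p ^+ k.+1)).
Proof. by rewrite /wp_factor big_ord_recr. Qed.

(** Replacing z by pz shifts the index of numerators and denominators by one, so the quotient of the
    two products telescopes to boundary factors. *)
Lemma wp_factor_shift (F : fieldType) (a p z : F) (k : nat) :
  (forall i, 1 - a * z * p ^+ i.+1 != 0) ->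
  (p * z - p ^+ k) * (1 - a * (p * z) * p ^+ k) * wp_factor F a p (p * z) k
  = p ^+ k * (p * z - 1) * (1 - a * (p * z)) * wp_factor F a p z k.
Proof.
move=> nz; elim: k => [|k IH].
  by rewrite /wp_factor !big_ord0 expr0 !mulr1 mul1r.
rewrite !wp_factorS.
have dk l : 1 - a * (p * z) * p ^+ l != 0.
  by rewrite (_ : a * _ * _ = a * z * p ^+ l.+1) // exprS; ring.
have d0 := dk k; have d1 := dk k.+1; have d2 := nz k.
transitivity (p * (z - p ^+ k) *
  ((p * z - p ^+ k) * (1 - a * (p * z) * p ^+ k) * wp_factor F a p (p * z) k)
  / (1 - a * (p * z) * p ^+ k)).
  by rewrite exprS in d1 *; field; rewrite d0 d1.
rewrite IH exprS in d2 *; field; rewrite ?d0 ?d2 //.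
Qed.

Lemma newton_eq0 (F : fieldType) (a p : F) (k j : nat) :
  p != 0 -> (k < j)%N -> newton F a p k j = 0.
Proof.
move=> p0 kj; rewrite /newton /qpoch (bigD1 (Ordinal kj) (P := xpredT)) //=.
rewrite [X in _ * X](bigD1 (Ordinal kj)) //=.
by rewrite mulVf ?expf_neq0 // subrr mul0r mulr0.
Qed.

Lemma newtonS (F : fieldType) (a p : F) (k j : nat) :
  newton F a p k j.+1
  = newton F a p k j * ((1 - a * p ^+ k * p ^+ j) * (1 - p ^- k * p ^+ j)).
Proof. by rewrite /newton !qpochS; ring. Qed.

(** Each factor 1 - p^(-i) with 1 <= i <= n is -p^(-i) (1 - p^i). *)
Lemma qpochV (F : fieldType) (p : F) (n : nat) : p != 0 ->
  (-1) ^+ n * p ^+ 'C(n.+1, 2) * qpoch (p ^- n) p n = qpoch p p n.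
Proof.
move=> p0; elim: n => [|n IH]; first by rewrite !qpoch0 !expr0 !mulr1.
rewrite qpochSl qpochS -IH binS bin1 exprD [(-1) ^+ n.+1]exprS.
have -> : p ^- n.+1 * p = p ^- n.
  by rewrite exprS; field; rewrite ?p0 ?expf_neq0.
by rewrite exprS; field; rewrite ?p0 ?expf_neq0.
Qed.

(* Up to a constant, [wp_term] at [n] is [wp_term] at [n + 1] times an affine
   function of [a * p ^+ k + p ^- k], and multiplication by this function maps
   [newton _ j] to a combination of [newton _ j] and [newton _ j.+1]: hence an
   induction on [n] with an inner descending induction on [j], starting from
   [j = n] where only the term [k = n] survives. *)
Lemma wp_sum (F : fieldType) (a p x : F) (n j : nat) :
  p != 0 -> (forall i, 1 - p ^+ i.+1 != 0) ->
  (forall i, 1 - a * p ^+ i != 0) -> (forall i, 1 - a * x * p ^+ i.+1 != 0) ->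
  (j <= n)%N ->
  \sum_(k < n.+1) wp_term F a p x (p ^+ n) k * newton F a p k j
  = qpoch a p n.+1 / qpoch (a * x * p) p n * a ^+ j
    * \prod_(i < j) ((x - p ^+ i) * (p ^+ n - p ^+ i)).
Proof.
move=> p0 pnz anz xnz.
have qpnz m : qpoch p p m != 0.
  by apply: qpoch_neq0 => i _; rewrite -exprS; apply: pnz.
have qanz m i : qpoch (a * p ^+ i) p m != 0.
  by apply: qpoch_neq0 => l _; rewrite -mulrA -exprD; apply: anz.
have qxnz m : qpoch (a * x * p) p m != 0.
  by apply: qpoch_neq0 => l _; rewrite -mulrA -exprS.
have pkz k : p ^+ k != 0 by rewrite expf_neq0.
have facE y m : wp_factor F a p y m =
    \prod_(i < m) (y - p ^+ i) / qpoch (a * y * p) p m.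
  rewrite /wp_factor prodf_div; congr (_ / _); apply: eq_bigr => i _.
  by rewrite exprS !mulrA.
have diag m : \sum_(k < m.+1) wp_term F a p x (p ^+ m) k * newton F a p k m
  = qpoch a p m.+1 / qpoch (a * x * p) p m * a ^+ m
    * \prod_(i < m) ((x - p ^+ i) * (p ^+ m - p ^+ i)).
  rewrite big_ord_recr big1 ?add0r => [|k _]; last by rewrite newton_eq0 ?mulr0 /= ?ltn_ord.
  rewrite /= /wp_term /newton big_split /= !facE -(qpochV F p m p0).
  rewrite -(mulrA a (p ^+ m) p) -exprSr.
  have sgnz : (-1) ^+ m != 0 :> F by rewrite signr_eq0.
  (* Both sides are (a;p)_(2m+1), cut at different places. *)
  have rearr : (1 - a * p ^+ (2 * m)) * qpoch (a * p ^+ m) p m * qpoch a p m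
     = qpoch a p m.+1 * qpoch (a * p ^+ m.+1) p m.
    rewrite -qpochD addSn qpochS qpochD mul2n addnn; ring.
  have vnz : qpoch (p ^- m) p m != 0.
    by apply: contraNneq (qpnz m) => h; rewrite -(qpochV F p m p0) h mulr0.
  have := qanz m m.+1; have := qxnz m; have := pkz 'C(m.+1, 2).
  move: rearr; move: (qpoch a p m) (qpoch (a * p ^+ m) p m) => A B.
  move: (qpoch a p m.+1) (qpoch (a * p ^+ m.+1) p m) => C D.
  set X := (\prod_(i < m) (x - _)); set Y := (\prod_(i < m) (p ^+ m - _)).
  move=> rearr h1 h2 h3.
  transitivity ((1 - a * p ^+ (2 * m)) * B * A * a ^+ m * X * Y
     / (qpoch (a * x * p) p m * D)).
    by field; rewrite ?h1 ?h2 ?h3 ?vnz ?sgnz.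
  by rewrite rearr; field; rewrite h2 h3.
elim: n j => [|n IHn] j; first by rewrite leqn0 => /eqP ->; apply: diag.
have step l : (p ^+ n.+1 - p ^+ l) * (1 - a * p ^+ n.+1 * p ^+ l)
    * (\sum_(k < n.+2) wp_term F a p x (p ^+ n.+1) k * newton F a p k l)
  = p ^+ n.+1
    * (\sum_(k < n.+2) wp_term F a p x (p ^+ n.+1) k * newton F a p k l.+1)
    + p ^+ l * (p ^+ n.+1 - 1) * (1 - a * p ^+ n.+1)
      * (\sum_(k < n.+1) wp_term F a p x (p ^+ n) k * newton F a p k l).
  (* With y_i = a p^i + p^(-i), this is y_l - y_(n+1) = (y_l - y_k) + (y_k - y_(n+1)), scaled by
     p^(n+1+l). *)
  have core k : (p ^+ n.+1 - p ^+ l) * (1 - a * p ^+ n.+1 * p ^+ l)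
      * (wp_term F a p x (p ^+ n.+1) k * newton F a p k l)
    = p ^+ n.+1 * (wp_term F a p x (p ^+ n.+1) k * newton F a p k l.+1)
    + p ^+ l / p ^+ k * ((p ^+ n.+1 - p ^+ k) * (1 - a * p ^+ n.+1 * p ^+ k))
      * (wp_term F a p x (p ^+ n.+1) k * newton F a p k l).
    by rewrite newtonS; field; apply: pkz.
  (* At k = n + 1 the last summand of [core] is zero, which is why the sum at [n] has one term
     fewer. *)
  rewrite ![\sum_(k < n.+2) _]big_ord_recr /= [LHS]mulrDr.
  rewrite [X in _ = X + _]mulrDr core subrr mul0r mulr0.
  rewrite mul0r addr0 addrAC; congr (_ + _).
  rewrite !mulr_sumr -big_split /=; apply: eq_bigr => k _.
  rewrite core; congr (_ + _).
  have := @wp_factor_shift F a p (p ^+ n) k.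
  rewrite -!exprS => shift.
  transitivity (p ^+ l / p ^+ k * ((-1) ^+ k * a ^+ k * p ^+ 'C(k.+1, 2)
     * (1 - a * p ^+ (2 * k)) * qpoch a p k / qpoch p p k * wp_factor F a p x k)
     * ((p ^+ n.+1 - p ^+ k) * (1 - a * p ^+ n.+1 * p ^+ k)
        * wp_factor F a p (p ^+ n.+1) k) * newton F a p k l).
    by rewrite /wp_term; ring.
  rewrite shift => [|i]; last by rewrite -mulrA -exprD; apply: anz.
  by rewrite /wp_term; field; rewrite pkz qpnz.
move=> jn; rewrite -(subKn jn); elim: (n.+1 - j)%N => [|i IHi].
  by rewrite subn0; apply: diag.
(* For i > n both subtractions are truncated to 0. *)
case: (ltnP n i) => [ni|ni].
  have -> : (n.+1 - i.+1 = n.+1 - i)%N; last exact: IHi.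
  have /eqP -> : (n.+1 - i.+1 == 0)%N by rewrite subn_eq0 ltnW.
  by apply/esym/eqP; rewrite subn_eq0.
rewrite subSS; set l := (n - i)%N.
have ln : (l <= n)%N by apply: leq_subr.
have eqS : (n.+1 - i)%N = l.+1 by rewrite subSn.
have cnz : (p ^+ n.+1 - p ^+ l) * (1 - a * p ^+ n.+1 * p ^+ l) != 0.
  rewrite mulf_neq0 // -?mulrA -?exprD ?anz //.
  have -> : p ^+ n.+1 = p ^+ l * p ^+ (n - l).+1 by rewrite -exprD addnS subnKC.
  by rewrite -[X in _ - X]mulr1 -mulrBr mulf_neq0 // -opprB oppr_eq0.
apply: (mulfI cnz); rewrite step -eqS IHi IHn // eqS.
rewrite [\prod_(_ < l.+1) _]big_ord_recr !big_split /=.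
have prodE : \prod_(i < l) (p ^+ n.+1 - p ^+ i) * (p ^+ n.+1 - p ^+ l)
    = p ^+ l * (p ^+ n.+1 - 1) * \prod_(i < l) (p ^+ n - p ^+ i).
  rewrite -(big_ord_recr l (fun i : 'I_l.+1 => p ^+ n.+1 - p ^+ i)).
  rewrite big_ord_recl expr0 [p ^+ l * _]mulrC -mulrA; congr (_ * _).
  have -> : p ^+ l = \prod_(i < l) p by rewrite prodr_const card_ord.
  rewrite -big_split /=.
  by apply: eq_bigr => k _; rewrite /bump leq0n add1n !exprS mulrBr.
rewrite [qpoch a p n.+2]qpochS [qpoch (a * x * p) p n.+1]qpochS.
have h1 : 1 - a * x * p * p ^+ n != 0 by rewrite -[_ * p ^+ n]mulrA -exprS.
move: prodE (qxnz n.+1) (qxnz n); rewrite [qpoch (a * x * p) p n.+1]qpochS.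
set X := (\prod_(_ < l) (x - _)); set Y := (\prod_(_ < l) (_ - _)).
set Z := (\prod_(_ < l) (_ - _)); set Q := qpoch (a * x * p) p n.
set A := qpoch a p n.+1; set u := p ^+ l * (p ^+ n.+1 - 1).
move=> prodE h2 h3.
(* By [prodE] the last bracket has a common factor, whose cofactor a p^(n+1) (x - p^l) + 1 - a x
   p^(n+1) equals 1 - a p^(n+1+l), free of x. *)
transitivity (A * (1 - a * p ^+ n.+1) * a ^+ l / (Q * (1 - a * x * p * p ^+ n))
  * X * (p ^+ n.+1 * a * (x - p ^+ l) * (Y * (p ^+ n.+1 - p ^+ l))
         + (1 - a * x * p * p ^+ n) * (u * Z))).
  by rewrite !exprS; field; rewrite h1 h3.
by rewrite -prodE exprS; field; rewrite h1 h3.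
Qed.

(* The left-hand side telescopes in [j]; the right-hand side vanishes for
   [k < m], which leaves a first-order recurrence in [k]. *)
Lemma saalschutz_rec (F : fieldType) (a b p : F) (k m : nat) :
  p != 0 -> (forall i, 1 - p ^+ i.+1 != 0) ->
  (forall i, 1 - a * p ^+ i != 0) -> (forall i, 1 - b * p ^+ i != 0) ->
  let U l := \sum_(j < m.+1) newton F a p l j * p ^+ j
               / ((1 - b * p ^+ j) * qpoch p p j * qpoch a p j) in
  (1 - b * p ^+ k.+1) * (1 - a * p ^+ k) * U k.+1
  - (1 - p ^+ k.+1) * (b - a * p ^+ k) * U k
  = (1 - a * p ^+ (2 * k).+1)
    * (qpoch (a * p ^+ k.+1) p m * qpoch (p ^- k) p m
       / (qpoch p p m * qpoch a p m)).
Proof.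
move=> p0 pnz anz bnz /=.
have qpnz l : qpoch p p l != 0.
  by apply: qpoch_neq0 => i _; rewrite -exprS; apply: pnz.
have qanz l : qpoch a p l != 0 by apply: qpoch_neq0 => i _; apply: anz.
have pkz l : p ^+ l != 0 by rewrite expf_neq0.
elim: m => [|m IH].
  rewrite !big_ord_recl !big_ord0 /newton !qpoch0 expr0 !mulr1 !addr0.
  have := bnz 0%N; rewrite expr0 mulr1 => b0.
  by rewrite mul2n -addnn !exprS exprD; field; rewrite b0 oner_neq0.
rewrite ![\sum_(j < m.+2) _]big_ord_recr /= !(mulrDr _ (\sum_(_ < _) _)).
rewrite opprD addrACA IH.
have -> : newton F a p k.+1 m.+1 = qpoch (a * p ^+ k.+1) p m
    * (1 - a * p ^+ k.+1 * p ^+ m) * ((1 - p ^- k.+1) * qpoch (p ^- k) p m).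
  rewrite /newton qpochS qpochSl; congr (_ * (_ * qpoch _ _ _)).
  by rewrite exprS; field; rewrite p0 pkz.
have -> : newton F a p k m.+1 = (1 - a * p ^+ k) * qpoch (a * p ^+ k.+1) p m
    * (qpoch (p ^- k) p m * (1 - p ^- k * p ^+ m)).
  by rewrite /newton qpochSl qpochS -[_ * p]mulrA -exprSr.
rewrite !qpochS.
have h1 := bnz m.+1; have h2 := anz m; have h3 := pnz m.
have h4 := qpnz m; have h5 := qanz m; have h6 := pkz k; have h7 := pkz m.
rewrite mul2n -addnn !exprS !exprD in h1 h2 h3 *.
by field; rewrite h1 h2 h3 h4 h5 h6 p0.
Qed.

(** A balanced 3phi2 in base p, since 1/(1 - b p^j) = (b;p)_j / ((1 - b) (bp;p)_j). The terms with j
    > k vanish, so the bound [m] can stay fixed while the recurrence runs in [k]. *)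
Lemma saalschutz (F : fieldType) (a b p : F) (k m : nat) :
  p != 0 -> (forall i, 1 - p ^+ i.+1 != 0) ->
  (forall i, 1 - a * p ^+ i != 0) -> (forall i, 1 - b * p ^+ i != 0) ->
  (k < m)%N ->
  \sum_(j < m) newton F a p k j * p ^+ j
               / ((1 - b * p ^+ j) * qpoch p p j * qpoch a p j)
  = qpoch p p k * \prod_(i < k) (b - a * p ^+ i)
    / (qpoch a p k * qpoch b p k.+1).
Proof.
move=> p0 pnz anz bnz; case: m => // m; rewrite ltnS.
have qanz l : qpoch a p l != 0 by apply: qpoch_neq0 => i _; apply: anz.
have qbnz l : qpoch b p l != 0 by apply: qpoch_neq0 => i _; apply: bnz.
elim: k => [_|k IH km].
  rewrite big_ord_recl big1 ?addr0 => [|j _]; last first.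
    by rewrite newton_eq0 ?mul0r.
  by rewrite /newton big_ord0 qpochS !qpoch0 !expr0 !mulr1 !mul1r.
have := saalschutz_rec F a b p k m p0 pnz anz bnz => /=.
rewrite IH ?(ltnW km) //.
have -> : qpoch (p ^- k) p m = 0.
  rewrite /qpoch (bigD1 (Ordinal km)) //= mulVf ?expf_neq0 // subrr.
  by rewrite mul0r.
rewrite mulr0 mul0r mulr0 => /eqP; rewrite subr_eq0 => /eqP eqU.
have cnz : (1 - b * p ^+ k.+1) * (1 - a * p ^+ k) != 0 by rewrite mulf_neq0.
apply: (mulfI cnz); rewrite eqU big_ord_recr /= [qpoch b p k.+2]qpochS.
rewrite [qpoch p p k.+1]qpochS [qpoch a p k.+1]qpochS -[p * p ^+ k]exprS.
have h1 := qanz k; have h2 := qbnz k.+1; have h3 := anz k; have h4 := bnz k.+1.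
by field; rewrite h1 h2 h3 h4.
Qed.

(* Both sides are the double sum of [wp_term k * newton k j] against the weights
   of [saalschutz], at [x = (a * qn)^-1]: summing first over [j] uses
   [saalschutz], summing first over [k] uses [wp_sum]. *)
Lemma watson_limit (F : fieldType) (b p : F) (n : nat) :
  let a := b ^+ 2 in let qn := a * p ^+ n in
  let r k := \prod_(i < k) ((1 - a * p ^+ i * qn) * (1 - a * p ^+ i / qn)) in
  p != 0 -> b != 0 -> (forall i, 1 - p ^+ i.+1 != 0) ->
  (forall i, 1 - a * p ^+ i != 0) -> (forall i, 1 - b * p ^+ i != 0) ->
  (forall i, 1 - p ^+ i.+1 / qn != 0) ->
  \sum_(k < n.+1) (-1) ^+ k * p ^+ 'C(k.+1, 2) / b ^+ k * (1 + b * p ^+ k)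
     * (r k / \prod_(i < k) ((1 - p ^+ i.+1 * qn) * (1 - p ^+ i.+1 / qn)))
  = (-1) ^+ n * a ^+ n * p ^+ 'C(n, 2) * (1 - qn)
    * \sum_(k < n.+1) (p / a) ^+ k * r k
        / ((1 - b * p ^+ k) * qpoch p p k * qpoch a p k).
Proof.
move=> a qn r p0 b0 pnz anz bnz qnz.
have a0 : a != 0 by rewrite expf_neq0.
have pkz l : p ^+ l != 0 by rewrite expf_neq0.
have qn0 : qn != 0 by rewrite mulf_neq0.
(* This choice gives a x = 1/qn, while the other parameter gives a p^n = qn: the two families of
   denominators become 1 - p^(i+1)/qn and 1 - p^(i+1) qn. *)
pose x := (a * qn)^-1.
have axE : a * x = qn^-1 by rewrite /x invfM mulVKf.
have xnz i : 1 - a * x * p ^+ i.+1 != 0 by rewrite axE mulrC.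
have qpnz l : qpoch p p l != 0.
  by apply: qpoch_neq0 => i _; rewrite -exprS; apply: pnz.
have qanz l : qpoch a p l != 0 by apply: qpoch_neq0 => i _; apply: anz.
have rE k : \prod_(i < k) ((x - p ^+ i) * (p ^+ n - p ^+ i)) = r k / a ^+ (2 * k).
  rewrite exprM -[X in _ / _ ^+ X](card_ord k) -prodr_const -prodf_div.
  apply: eq_bigr => i _; rewrite /x /qn; field.
  by rewrite a0 pkz.
have wE k : wp_factor F a p x k * wp_factor F a p (p ^+ n) k
    = r k / a ^+ (2 * k)
      / \prod_(i < k) ((1 - p ^+ i.+1 * qn) * (1 - p ^+ i.+1 / qn)).
  rewrite /wp_factor -big_split /= -rE -prodf_div; apply: eq_bigr => i _.
  rewrite axE mulf_div; congr (_ / _); rewrite mulrC -/qn.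
  by rewrite [qn * _]mulrC [qn^-1 * _]mulrC.
have KE : qpoch a p n.+1 / qpoch (a * x * p) p n
    = (-1) ^+ n * a ^+ n * p ^+ 'C(n, 2) * (1 - qn).
  (* Reversing the factors of [qpoch (a * x * p) p n] gives the product of the 1 - 1/(a p^i), each
     equal to -(1 - a p^i)/(a p^i). *)
  have revE : (-1) ^+ n * a ^+ n * p ^+ 'C(n, 2) * qpoch (a * x * p) p n
      = qpoch a p n.
    have -> : qpoch (a * x * p) p n = \prod_(i < n) (1 - (a * p ^+ i)^-1).
      rewrite /qpoch (reindex_inj rev_ord_inj); apply: eq_bigr => i _ /=.
      rewrite axE -mulrA -exprS -subSn // subSS /qn.
      have -> : p ^+ n = p ^+ (n - i) * p ^+ i.
        by rewrite -exprD subnK // ltnW.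
      by congr (1 - _); field; rewrite a0 !pkz.
    rewrite /qpoch; elim: (n) => [|l IH].
      by rewrite !big_ord0 !expr0 !mulr1.
    rewrite !big_ord_recr /= -IH binS bin1 exprD !exprS.
    by field; rewrite a0 pkz.
  have qxnz : qpoch (a * x * p) p n != 0.
    by apply: contraNneq (qanz n) => h; rewrite -revE h mulr0.
  by rewrite qpochS -revE -/qn; field.
transitivity (\sum_(k < n.+1) wp_term F a p x (p ^+ n) k *
  \sum_(j < n.+1) newton F a p k j * p ^+ j
               / ((1 - b * p ^+ j) * qpoch p p j * qpoch a p j)).
  apply: eq_bigr => k _; rewrite (saalschutz F a b p k n.+1) //.
  (* Here a = b^2 matters: (b;p)_k cancels from the value of the inner sum, and of 1 - a p^(2k) = (1
     - b p^k)(1 + b p^k) only 1 + b p^k remains. *)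
  have -> : \prod_(i < k) (b - a * p ^+ i) = b ^+ k * qpoch b p k.
    rewrite -[X in _ ^+ X](card_ord k) -prodr_const -big_split /=.
    by apply: eq_bigr => i _; rewrite /a; ring.
  have h1 := qpnz k; have h2 := qanz k; have h3 := bnz k.
  have h4 : qpoch b p k != 0 by apply: qpoch_neq0.
  have h5 : b ^+ k != 0 by rewrite expf_neq0.
  rewrite /wp_term wE qpochS -mulrA.
  have bb : a ^+ k = b ^+ k * b ^+ k by rewrite -exprMn.
  have pp2 : p ^+ (2 * k) = p ^+ k * p ^+ k by rewrite mul2n -addnn exprD.
  have a2 : a ^+ (2 * k) = a ^+ k * a ^+ k by rewrite mul2n -addnn exprD.
  set P := (\prod_(i < k) (_ * (1 - _ / _)))^-1.
  rewrite a2 bb pp2 /a; field; rewrite h1 h2 h3 h4 h5 //.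
under eq_bigr => k _ do rewrite mulr_sumr.
rewrite exchange_big /= mulr_sumr; apply: eq_bigr => j _.
under eq_bigr => k _.
  rewrite mulrA [wp_term _ _ _ _ _ _ * (newton _ _ _ _ _ * _)]mulrA.
  over.
have jn : (j <= n)%N by rewrite -ltnS.
rewrite -!mulr_suml wp_sum // KE rE.
have h1 := qpnz j; have h2 := qanz j; have h3 := bnz j.
have h4 : a ^+ j != 0 by rewrite expf_neq0.
rewrite mul2n -addnn exprD expr_div_n; field.
by rewrite h1 h2 h3 h4.
Qed.

(** * Congruences between rational functions *)

(* The embedding [f] will be [FracField.tofrac]; it is kept abstract because
   unification tends to compute in the concrete field of fractions. *)
Definition regular (F : fieldType) (f : {rmorphism {poly rat} -> F})
    (P : {poly rat}) (x : F) : Prop :=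
  exists u v : {poly rat}, [/\ f v != 0, coprimep v P & x = f u / f v].

Lemma regular_poly (F : fieldType) (f : {rmorphism {poly rat} -> F})
    (P u : {poly rat}) : regular F f P (f u).
Proof.
by exists u, 1; rewrite rmorph1 oner_neq0 coprime1p divr1.
Qed.

Lemma regularV (F : fieldType) (f : {rmorphism {poly rat} -> F})
    (P v : {poly rat}) :
  f v != 0 -> coprimep v P -> regular F f P (f v)^-1.
Proof. by move=> v0 vP; exists 1, v; rewrite v0 vP rmorph1 mul1r. Qed.

Lemma regularD (F : fieldType) (f : {rmorphism {poly rat} -> F})
    (P : {poly rat}) (x y : F) :
  regular F f P x -> regular F f P y -> regular F f P (x + y).
Proof.
move=> [u [v [v0 vP ->]]] [s [t [t0 tP ->]]].
exists (u * t + s * v), (v * t).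
rewrite coprimepMl vP tP rmorphM mulf_neq0 //; split=> //.
rewrite rmorphD !rmorphM; field.
by rewrite v0 t0.
Qed.

Lemma regularM (F : fieldType) (f : {rmorphism {poly rat} -> F})
    (P : {poly rat}) (x y : F) :
  regular F f P x -> regular F f P y -> regular F f P (x * y).
Proof.
move=> [u [v [v0 vP ->]]] [s [t [t0 tP ->]]].
exists (u * s), (v * t).
by rewrite coprimepMl vP tP !rmorphM mulf_neq0 // mulf_div.
Qed.

Lemma regular1 (F : fieldType) (f : {rmorphism {poly rat} -> F})
    (P : {poly rat}) : regular F f P 1.
Proof. by rewrite -(rmorph1 f); apply: regular_poly. Qed.

Lemma regularN (F : fieldType) (f : {rmorphism {poly rat} -> F})
    (P : {poly rat}) (x : F) :
  regular F f P x -> regular F f P (- x).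
Proof.
move=> rx; rewrite -mulN1r; apply: regularM => //.
by rewrite -(rmorph1 f) -rmorphN; apply: regular_poly.
Qed.

Lemma regularX (F : fieldType) (f : {rmorphism {poly rat} -> F})
    (P : {poly rat}) (x : F) (k : nat) :
  regular F f P x -> regular F f P (x ^+ k).
Proof.
by move=> rx; elim: k => [|k IH];
  [apply: regular1 | rewrite exprS; apply: regularM].
Qed.

(** Requiring both sides to be regular makes the relation compatible with products. *)
Definition congr_mod (F : fieldType) (f : {rmorphism {poly rat} -> F})
    (P : {poly rat}) (x y : F) : Prop :=
  [/\ regular F f P x, regular F f P y & exists2 r, regular F f P r & x - y = f P * r].

Lemma congr_mod_refl (F : fieldType) (f : {rmorphism {poly rat} -> F})
    (P : {poly rat}) (x : F) :
  regular F f P x -> congr_mod F f P x x.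
Proof.
move=> rx; split=> //; exists 0; last by rewrite subrr mulr0.
by rewrite -(rmorph0 f); apply: regular_poly.
Qed.

Lemma congr_mod_trans (F : fieldType) (f : {rmorphism {poly rat} -> F})
    (P : {poly rat}) (y x z : F) :
  congr_mod F f P x y -> congr_mod F f P y z -> congr_mod F f P x z.
Proof.
move=> [rx ry [r rr e]] [_ rz [s rs h]]; split=> //.
exists (r + s); first exact: regularD.
by rewrite mulrDr -e -h addrA subrK.
Qed.

Lemma congr_mod_add (F : fieldType) (f : {rmorphism {poly rat} -> F})
    (P : {poly rat}) (x y z t : F) :
  congr_mod F f P x y -> congr_mod F f P z t -> congr_mod F f P (x + z) (y + t).
Proof.
move=> [rx ry [r rr e]] [rz rt [s rs h]]; split; try exact: regularD.
exists (r + s); first exact: regularD.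
by rewrite mulrDr -e -h opprD addrACA.
Qed.

Lemma congr_mod_mul (F : fieldType) (f : {rmorphism {poly rat} -> F})
    (P : {poly rat}) (x y z t : F) :
  congr_mod F f P x y -> congr_mod F f P z t -> congr_mod F f P (x * z) (y * t).
Proof.
move=> [rx ry [r rr e]] [rz rt [s rs h]]; split; try exact: regularM.
exists (r * z + y * s); first by apply: regularD; apply: regularM.
by rewrite mulrDr mulrA -e mulrCA -h; ring.
Qed.

Lemma congr_mod_exp (F : fieldType) (f : {rmorphism {poly rat} -> F})
    (P : {poly rat}) (x y : F) (k : nat) :
  congr_mod F f P x y -> congr_mod F f P (x ^+ k) (y ^+ k).
Proof.
move=> xy; elim: k => [|k IH]; first exact/congr_mod_refl/regular1.
by rewrite !exprS; apply: congr_mod_mul.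
Qed.

Lemma congr_mod_sum (F : fieldType) (f : {rmorphism {poly rat} -> F})
    (P : {poly rat}) (m : nat) (Q : pred 'I_m)
    (u v : 'I_m -> F) :
  (forall i, Q i -> congr_mod F f P (u i) (v i)) ->
  congr_mod F f P (\sum_(i < m | Q i) u i) (\sum_(i < m | Q i) v i).
Proof.
move=> uv; elim/big_ind2: _ => //; last by move=> *; apply: congr_mod_add.
by apply: congr_mod_refl; rewrite -(rmorph0 f); apply: regular_poly.
Qed.

Lemma congr_mod_prod (F : fieldType) (f : {rmorphism {poly rat} -> F})
    (P : {poly rat}) (m : nat) (u v : 'I_m -> F) :
  (forall i, congr_mod F f P (u i) (v i)) ->
  congr_mod F f P (\prod_(i < m) u i) (\prod_(i < m) v i).
Proof.
move=> uv; elim/big_ind2: _ => //; last by move=> *; apply: congr_mod_mul.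
exact/congr_mod_refl/regular1.
Qed.

Lemma congr_modV (F : fieldType) (f : {rmorphism {poly rat} -> F})
    (P : {poly rat}) (x y : F) :
  x != 0 -> y != 0 -> regular F f P x^-1 -> regular F f P y^-1 ->
  congr_mod F f P x y -> congr_mod F f P x^-1 y^-1.
Proof.
move=> x0 y0 rx ry [_ _ [r rr e]]; split=> //.
exists (- (r * x^-1 * y^-1)).
  by apply: regularN; do 2 apply: regularM => //.
rewrite mulrN !mulrA -e; field.
by rewrite x0 y0.
Qed.

Lemma rmorph_div_cancel (R : comNzRingType) (F : fieldType)
    (f : {rmorphism R -> F}) (P u v g u1 v1 : R) :
  u1 * g = P * u -> v1 * g = v -> f g != 0 -> f P * (f u / f v) = f u1 / f v1.
Proof.
by move=> eu <- g0; rewrite mulrA -rmorphM -eu !rmorphM -mulf_div divff ?mulr1.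
Qed.

(** The gcd removed to reach lowest terms divides [v], hence is coprime to [P], so [P] still divides
    the reduced numerator. *)
Lemma congr_mod_qcongr (P : {poly rat}) (x y : ratfun) :
  congr_mod ratfun (@FracField.tofrac {poly rat}) P x y -> qcongr P x y.
Proof.
move=> [_ _ [r [u [v [fv0 vP er]]] exy]].
have v0 : v != 0 by move: fv0; rewrite tofrac_eq0.
set g := gcdp (P * u) v.
have g0 : g != 0 by rewrite gcdp_eq0 negb_and v0 orbT.
have eu : P * u %/ g * g = P * u by rewrite divpK // dvdp_gcdl.
have ev : v %/ g * g = v by rewrite divpK // dvdp_gcdr.
exists (P * u %/ g), (v %/ g); split.
- by apply: contraNneq v0 => h; rewrite -ev h mul0r.
- by apply: coprimep_div_gcd; rewrite v0 orbT.
- rewrite exy er; apply: rmorph_div_cancel eu ev _.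
  by rewrite tofrac_eq0.
- have gP : coprimep P g.
    by rewrite coprimep_sym; apply: coprimep_dvdr vP; apply: dvdp_gcdr.
  by rewrite -(Gauss_dvdpl _ gP) eu dvdp_mulr.
- by apply: coprimep_dvdr vP; rewrite -{2}ev dvdp_mulr.
Qed.

Lemma congr_mod_scale (F : fieldType) (f : {rmorphism {poly rat} -> F})
    (P : {poly rat}) (c x y : F) :
  regular F f P c -> congr_mod F f P x y -> congr_mod F f P (c * x) (c * y).
Proof. by move=> rc; apply/congr_mod_mul/congr_mod_refl. Qed.

Lemma regularVM (F : fieldType) (f : {rmorphism {poly rat} -> F})
    (P : {poly rat}) (x y : F) :
  regular F f P x^-1 -> regular F f P y^-1 -> regular F f P (x * y)^-1.
Proof. by move=> rx ry; rewrite invfM; apply: regularM. Qed.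

Lemma regular_prod (F : fieldType) (f : {rmorphism {poly rat} -> F})
    (P : {poly rat}) (m : nat) (u : 'I_m -> F) :
  (forall i, regular F f P (u i)) -> regular F f P (\prod_(i < m) u i).
Proof.
move=> ru; elim/big_ind: _ => //; first exact: regular1.
by move=> *; apply: regularM.
Qed.

(** * Cyclotomic polynomials *)

Lemma root_Phi (n : nat) (z : algC) :
  (0 < n)%N -> root (map_poly ratr (Phi n)) z -> n.-primitive_root z.
Proof.
move=> n0; have [w prim_w] := C_prim_root_exists n0.
rewrite /Phi -map_poly_comp (@eq_map_poly _ _ _ intr) => [|k]; last first.
  by rewrite /= rmorph_int.
by rewrite (Cintr_Cyclotomic prim_w) root_cyclotomic.
Qed.

Lemma Phi_dvd (n : nat) : (0 < n)%N -> Phi n %| 'X^n - 1.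
Proof.
move=> n0; have -> : 'X^n - 1 = map_poly intr ('X^n - 1) :> {poly rat}.
  by rewrite rmorphB /= map_polyXn rmorph1.
rewrite -(prod_Cyclotomic n0) rmorph_prod /= (big_rem n) /=.
  by rewrite dvdp_mulr.
by rewrite -dvdn_divisors.
Qed.

(** Substituting -X in Phi_n | X^n - 1 gives, for odd n, a divisor of X^n + 1; multiply the two
    divisibilities. *)
Lemma Phi_compN_mul_Phi_dvd (n : nat) : (0 < n)%N -> odd n ->
  (Phi n \Po (- 'X)) * Phi n %| 'X^(2 * n) - 1.
Proof.
move=> n0 n_odd; have /dvdpP[g eg] := Phi_dvd n n0.
have eh : (g \Po (- 'X)) * (Phi n \Po (- 'X)) = - ('X^n + 1).
  rewrite -comp_polyM -eg comp_polyB comp_Xn_poly comp_polyC exprNn -signr_odd.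
  by rewrite n_odd expr1 mulN1r opprD.
have -> : 'X^(2 * n) - 1 = ('X^n - 1) * ('X^n + 1) :> {poly rat}.
  by rewrite mulnC exprM; ring.
by rewrite -['X^n + 1]opprK -eh eg mulrN dvdpNr mulrC dvdp_mul // dvdp_mull.
Qed.

(** A common root z in [algC] has z^s = 1, and z or -z is a primitive n-th root of unity. Then n
    divides s or 2s, hence s as n is odd. *)
Lemma coprimep_Phi (n s : nat) : odd n -> ~~ (n %| s)%N ->
  coprimep (1 - 'X^s) ((Phi n \Po (- 'X)) ^+ 2 * Phi n ^+ 2).
Proof.
move=> n_odd ns; have n0 : (0 < n)%N by case: n n_odd {ns}.
have prim_false (z : algC) : z ^+ s = 1 ->
    n.-primitive_root z \/ n.-primitive_root (- z) -> False.
  move=> zs [] pz; move: ns; first by rewrite (prim_order_dvd pz) zs eqxx.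
  have -> : (n %| s)%N = (n %| 2 * s)%N by rewrite Gauss_dvdr // coprimen2.
  by rewrite (prim_order_dvd pz) exprM sqrrN -exprM mulnC exprM zs expr1n eqxx.
have rootE (z : algC) : root (map_poly ratr (1 - 'X^s)) z -> z ^+ s = 1.
  rewrite rmorphB /= rmorph1 map_polyXn rootE !hornerE.
  by rewrite subr_eq0 => /eqP.
rewrite coprimepMr; apply/andP; split; apply: coprimep_expr.
  rewrite -(coprimep_map (ratr : rat -> algC)).
  apply/Pdiv.ClosedField.coprimepP => z /rootE zs; apply/negP => rz.
  apply: (prim_false z zs); right; apply: (root_Phi _ _ n0).
  move: rz; rewrite map_comp_poly rmorphN /= map_polyX /root horner_comp.
  by rewrite !hornerE.
rewrite -(coprimep_map (ratr : rat -> algC)).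
apply/Pdiv.ClosedField.coprimepP => z /rootE zs; apply/negP => rz.
by apply: (prim_false z zs); left; apply: (root_Phi _ _ n0).
Qed.

(** * The supercongruence *)

(** [c_term] and [rhs_sum] copy [c_q] and the sum of the theorem over an abstract field; at [qvar]
    they are convertible to the originals. *)
Definition c_term (F : fieldType) (q : F) (d k : nat) : F :=
  (-1) ^+ k
  * ((1 + q ^+ (2 * d * k + 1)) * qpoch (q ^+ 2) (q ^+ (2 * d)) k ^+ 2
     / ((1 + q) * qpoch (q ^+ (2 * d)) (q ^+ (2 * d)) k ^+ 2))
  * q ^+ (d * k ^ 2 + (d - 1) * k).

Definition rhs_sum (F : fieldType) (q : F) (d m : nat) : F :=
  \sum_(0 <= k < m.+1)
    qpochs [:: q ^+ 2; q] (q ^+ (2 * d)) k * q ^+ (2 * (d - 1) * k)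
    / qpochs [:: q ^+ (2 * d); q ^+ (2 * d + 1)] (q ^+ (2 * d)) k.

Lemma double_bin2 (k : nat) : (2 * 'C(k.+1, 2) = k * k.+1)%N.
Proof. by elim: k => [|k IH] //; rewrite binS bin1 mulnDr IH; lia. Qed.

(** * Regular elements and units at Phi_n(q) Phi_n(-q), for odd n > 1 *)

Section Cyclotomic.
Variables (F : fieldType) (f : {rmorphism {poly rat} -> F}) (q : F) (n : nat).
Hypotheses (f_inj : injective f) (qE : q = f 'X)
  (n_gt1 : (1 < n)%N) (n_odd : odd n).
Let P : {poly rat} := (Phi n \Po (- 'X)) ^+ 2 * Phi n ^+ 2.
Let n_gt0 : (0 < n)%N := ltnW n_gt1.
Let Q := q ^+ (2 * n).
Local Notation reg := (regular F f P).
Local Notation cong := (congr_mod F f P).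

Lemma sub1qXE s : 1 - q ^+ s = f (1 - 'X^s).
Proof. by rewrite rmorphB rmorph1 rmorphXn qE. Qed.

Lemma sub1qX_neq0 s : (0 < s)%N -> 1 - q ^+ s != 0.
Proof.
move=> s0; rewrite sub1qXE raddf_eq0 //.
by rewrite -opprB oppr_eq0 monic_neq0 // monicXnsubC.
Qed.

Lemma q_neq0 : q != 0.
Proof. by rewrite qE raddf_eq0 // polyX_eq0. Qed.

Lemma add1q_neq0 : 1 + q != 0.
Proof.
have := sub1qX_neq0 2 isT; apply: contraNneq => h.
have -> : 1 - q ^+ 2 = (1 - q) * (1 + q) by ring.
by rewrite h mulr0.
Qed.

Lemma regular_sub1qXV s : ~~ (n %| s)%N -> reg (1 - q ^+ s)^-1.
Proof.
move=> ns; have s0 : (0 < s)%N by case: s ns => //; rewrite dvdn0.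
have := sub1qX_neq0 s s0; rewrite sub1qXE => h.
by apply: regularV => //; apply: coprimep_Phi.
Qed.

Lemma regular_qX s : reg (q ^+ s).
Proof. by apply: regularX; rewrite qE; apply: regular_poly. Qed.

Lemma regular_qXV s : reg (q ^+ s)^-1.
Proof.
rewrite -exprVn; apply: regularX; rewrite qE.
apply: regularV; first by rewrite -qE q_neq0.
have X1 : coprimep 'X ('X^(2 * n) - 1 : {poly rat}).
  rewrite coprimep_sym -['X]subr0 -polyC0 coprimep_XsubC /root !hornerE.
  by rewrite expr0n muln_eq0 /= (gtn_eqF n_gt0) sub0r oppr_eq0 oner_eq0.
have XA := coprimep_dvdl (Phi_compN_mul_Phi_dvd n n_gt0 n_odd) X1.
by rewrite /P -exprMn; apply: coprimep_expr.
Qed.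

Lemma regular_sub1qX s : reg (1 - q ^+ s).
Proof. by rewrite sub1qXE; apply: regular_poly. Qed.

Lemma regular_add1qX s : reg (1 + q ^+ s).
Proof. by apply: regularD; [apply: regular1 | apply: regular_qX]. Qed.

(** Holds because n does not divide 2. It fails for n = 1, where Phi_1(-q) = -(1 + q); that case is
    therefore treated apart. *)
Lemma regular_add1qV : reg (1 + q)^-1.
Proof.
have -> : (1 + q)^-1 = (1 - q ^+ 1) * (1 - q ^+ 2)^-1.
  have h1 := sub1qX_neq0 1 isT; have h2 := sub1qX_neq0 2 isT.
  by have h3 := add1q_neq0; field; rewrite h2 h3.
apply: regularM; first exact: regular_sub1qX.
apply: regular_sub1qXV; apply/negP => /dvdn_leq; move: n_odd n_gt1; lia.
Qed.

Lemma sub1Q_sqr : exists w, (1 - Q) ^+ 2 = f P * f w.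
Proof.
have /dvdpP[w ew] := Phi_compN_mul_Phi_dvd n n_gt0 n_odd.
exists (w ^+ 2); rewrite -rmorphM /P -exprMn -exprMn mulrC -ew.
by rewrite rmorphXn rmorphB rmorph1 rmorphXn -qE -/Q -[LHS]sqrrN opprB.
Qed.

Lemma congr_mod_sqr s :
  cong ((1 - q ^+ s * Q) * (1 - q ^+ s / Q)) ((1 - q ^+ s) ^+ 2).
Proof.
have [w ew] := sub1Q_sqr; have Q0 : Q != 0 by rewrite expf_neq0 ?q_neq0.
have rQ : reg (1 - q ^+ s * Q) by rewrite -exprD; apply: regular_sub1qX.
have rsQ : reg (q ^+ s / Q).
  by apply: regularM; [apply: regular_qX | apply: regular_qXV].
split.
- apply: regularM => //; apply: regularD; first exact: regular1.
  exact: regularN.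
- exact/regularX/regular_sub1qX.
(* Witness read off from (1 - yQ)(1 - y/Q) - (1 - y)^2 = -y (1 - Q)^2 / Q at y = q^s. *)
exists (- (q ^+ s / Q * f w)).
  by apply: regularN; apply: regularM => //; apply: regular_poly.
rewrite mulrN mulrCA -ew; field.
exact: Q0.
Qed.

Variables (d m : nat).
Hypotheses (d_ge3 : (3 <= d)%N) (dm : (d * m = n - 1)%N).
Let p := q ^+ (2 * d).

Lemma QE : q ^+ 2 * p ^+ m = Q.
Proof. by rewrite -exprM -exprD; congr (_ ^+ _); move: dm n_gt0; nia. Qed.

Lemma pXE k : p ^+ k = q ^+ (2 * d * k). Proof. by rewrite exprM. Qed.

Lemma apXE k : q ^+ 2 * p ^+ k = q ^+ (2 * (d * k + 1)).
Proof. by rewrite pXE -exprD; congr (_ ^+ _); lia. Qed.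

Lemma coprime_nd : coprime n d.
Proof.
have -> : n = (1 + d * m)%N by move: dm n_gt0; lia.
by rewrite coprime_sym /coprime addnC mulnC gcdnMDl gcdn1.
Qed.

Lemma ndvd2 s : (n %| 2 * s)%N = (n %| s)%N.
Proof. by rewrite Gauss_dvdr // coprimen2. Qed.

Lemma regular_pV k : (0 < k < n)%N -> reg (1 - p ^+ k)^-1.
Proof.
move=> /andP[k0 kn]; rewrite pXE; apply: regular_sub1qXV.
rewrite -mulnA ndvd2 Gauss_dvdr ?coprime_nd //.
by apply/negP => /(dvdn_leq k0); rewrite leqNgt kn.
Qed.

(** For k < m the exponent is 2(dk + 1) with 0 < dk + 1 < n; at k = m the factor would be 1 - Q,
    which is not invertible. *)
Lemma regular_apV k : (k < m)%N -> reg (1 - q ^+ 2 * p ^+ k)^-1.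
Proof.
move=> km; rewrite apXE; apply: regular_sub1qXV; rewrite ndvd2.
by apply/negP => /dvdn_leq; move: dm km n_gt0; nia.
Qed.

Lemma regular_qpoch_pV k : (k < n)%N -> reg (qpoch p p k)^-1.
Proof.
move=> kn; rewrite /qpoch -prodfV; apply: regular_prod => i.
by rewrite -exprS; apply: regular_pV; rewrite /= (leq_ltn_trans _ kn).
Qed.

Lemma regular_qpoch_aV k : (k <= m)%N -> reg (qpoch (q ^+ 2) p k)^-1.
Proof.
move=> km; rewrite /qpoch -prodfV; apply: regular_prod => i.
by apply: regular_apV; apply: leq_trans km.
Qed.

Lemma regular_qpoch_a k : reg (qpoch (q ^+ 2) p k).
Proof. by apply: regular_prod => i; rewrite apXE; apply: regular_sub1qX. Qed.

Lemma leq_3m : (3 * m <= n - 1)%N.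
Proof. by rewrite -dm leq_mul2r d_ge3 orbT. Qed.

Lemma c_termE k : c_term F q d k = ((-1) ^+ k * (1 + q ^+ (2 * d * k + 1))
    * q ^+ (d * k ^ 2 + (d - 1) * k) * (1 + q)^-1 * (qpoch p p k)^-1 ^+ 2)
    * qpoch (q ^+ 2) p k ^+ 2.
Proof. by rewrite /c_term -/p invfM exprVn; ring. Qed.

Lemma regular_c_term k : (k < n)%N -> reg (c_term F q d k).
Proof.
move=> kn; rewrite c_termE; apply: regularM; last first.
  exact/regularX/regular_qpoch_a.
apply: regularM; last exact/regularX/regular_qpoch_pV.
apply: regularM; last exact: regular_add1qV.
apply: regularM; last exact: regular_qX.
apply: regularM; last exact: regular_add1qX.
exact/regularX/regularN/regular1.
Qed.

Lemma c_term_congr0 k : (m < k < n)%N -> cong (c_term F q d k) 0.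
Proof.
move=> /andP[mk kn]; split; first exact: regular_c_term.
  by rewrite -(rmorph0 f); apply: regular_poly.
have [w ew] := sub1Q_sqr; rewrite subr0 c_termE.
(* [y] is (q^2;p)_k without its factor of index [m], which is 1 - Q. *)
pose y := qpoch (q ^+ 2) p m * qpoch (q ^+ 2 * p ^+ m.+1) p (k - m.+1).
have yE : qpoch (q ^+ 2) p k ^+ 2 = f P * (f w * y ^+ 2).
  rewrite -{1}(subnKC mk) qpochD [in LHS]qpochS QE mulrA -ew /y.
  set A := qpoch _ _ m; set B := qpoch _ _ _; ring.
have ry : reg y.
  apply: regularM; first exact: regular_qpoch_a.
  apply: regular_prod => i; rewrite -mulrA -exprD apXE.
  exact: regular_sub1qX.
set c := (_ * _ ^+ 2 in X in exists2 r, _ & X * _ = _).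
exists (c * (f w * y ^+ 2)); last by rewrite yE mulrCA.
apply: regularM; last first.
  by apply: regularM; [apply: regular_poly | apply: regularX].
rewrite /c; apply: regularM; last exact/regularX/regular_qpoch_pV.
apply: regularM; last exact: regular_add1qV.
apply: regularM; last exact: regular_qX.
apply: regularM; last exact: regular_add1qX.
exact/regularX/regularN/regular1.
Qed.

(** * Deforming the terms, and undoing the deformation after Watson's transformation *)

Let r k := \prod_(i < k) ((1 - q ^+ 2 * p ^+ i * Q) * (1 - q ^+ 2 * p ^+ i / Q)).

Lemma r_congr k : cong (r k) (qpoch (q ^+ 2) p k ^+ 2).
Proof.
rewrite /qpoch -prodrXl; apply: congr_mod_prod => i.
by rewrite apXE; apply: congr_mod_sqr.
Qed.

Lemma Q_neq0 : Q != 0. Proof. by rewrite expf_neq0 ?q_neq0. Qed.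

(** Trades a negative exponent for the unit -q^s/Q, so that the results on 1 - q^s apply. *)
Lemma sub1qXdivQE s : (s <= 2 * n)%N ->
  1 - q ^+ s / Q = - (q ^+ s / Q * (1 - q ^+ (2 * n - s))).
Proof.
move=> sn; have := Q_neq0; rewrite /Q -{1 2 3}(subnKC sn) exprD.
by rewrite mulf_eq0 negb_or => /andP[h1 h2]; field; rewrite h1 h2.
Qed.

Lemma sub1qXdivQ_neq0 s : s != (2 * n)%N -> 1 - q ^+ s / Q != 0.
Proof.
case: (ltngtP s (2 * n)) => // sn _.
  rewrite sub1qXdivQE ?(ltnW sn) // oppr_eq0 mulf_neq0 //.
    by rewrite mulf_neq0 ?invr_eq0 ?Q_neq0 // expf_neq0 ?q_neq0.
  by rewrite sub1qX_neq0 // subn_gt0.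
rewrite -(subnK (ltnW sn)) exprD mulfK ?Q_neq0 //.
by rewrite sub1qX_neq0 // subn_gt0.
Qed.

(** Equality would make d >= 3 divide n, to which it is coprime. Hence no denominator 1 - p^i/Q
    vanishes. *)
Lemma p_neq_Q i : (2 * d * i != 2 * n)%N.
Proof.
apply/eqP => h; have dn : (d %| n)%N.
  by apply/dvdnP; exists i; move: h; rewrite -mulnA mulnC; nia.
have := dvdn_gcd d n d; rewrite dn dvdnn (eqP coprime_nd) dvdn1 => /eqP h1.
by move: d_ge3; rewrite h1.
Qed.

(** Inverting [congr_mod_sqr] needs regular inverses: as 0 < d(i+1) < n and n is odd, n divides
    neither 2(d(i+1) + n) nor 2(n - d(i+1)). *)
Lemma r_den_congr k : (k <= m)%N ->
  cong (\prod_(i < k) ((1 - p ^+ i.+1 * Q) * (1 - p ^+ i.+1 / Q)))^-1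
    (qpoch p p k ^+ 2)^-1.
Proof.
move=> km; rewrite /qpoch -prodrXl -!prodfV; apply: congr_mod_prod => i.
have im : (i < m)%N by apply: leq_trans km.
have iN : (d * i.+1 < n)%N by move: dm im n_gt0; nia.
rewrite -exprS; apply: congr_modV; last by rewrite pXE; apply: congr_mod_sqr.
- rewrite mulf_neq0 // pXE ?sub1qXdivQ_neq0 ?p_neq_Q // -exprD sub1qX_neq0 //.
  by move: n_gt0; lia.
- by rewrite expf_neq0 // pXE sub1qX_neq0 //; move: d_ge3; lia.
- apply: regularVM.
    rewrite pXE -exprD; apply: regular_sub1qXV.
    rewrite -mulnA -mulnDr ndvd2 dvdn_addl // Gauss_dvdr ?coprime_nd //.
    by apply/negP => /dvdn_leq; move: iN d_ge3; nia.
  rewrite pXE sub1qXdivQE; last by move: iN; lia.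
  rewrite -mulNr; apply: regularVM.
    rewrite invrN invfM invrK; apply: regularN; apply: regularM.
      exact: regular_qXV.
    exact: regular_qX.
  apply: regular_sub1qXV; rewrite -mulnA -mulnBr ndvd2.
  by apply/negP => /dvdn_leq; move: iN d_ge3; nia.
rewrite -exprVn; apply: regularX; apply: regular_pV => /=.
by move: iN d_ge3; nia.
Qed.

Lemma term_congr k : (k <= m)%N ->
  cong ((1 + q)^-1 * ((-1) ^+ k * p ^+ 'C(k.+1, 2) / q ^+ k * (1 + q * p ^+ k)
     * (r k / \prod_(i < k) ((1 - p ^+ i.+1 * Q) * (1 - p ^+ i.+1 / Q)))))
    (c_term F q d k).
Proof.
move=> km; have -> : c_term F q d k = (1 + q)^-1 *
    ((-1) ^+ k * p ^+ 'C(k.+1, 2) / q ^+ k * (1 + q * p ^+ k)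
     * (qpoch (q ^+ 2) p k ^+ 2 / qpoch p p k ^+ 2)).
  rewrite c_termE.
  have -> : q ^+ (d * k ^ 2 + (d - 1) * k) = p ^+ 'C(k.+1, 2) / q ^+ k.
    apply: (canRL (mulfK _)); first by rewrite expf_neq0 ?q_neq0.
    rewrite -exprD pXE; congr (_ ^+ _).
    by have := double_bin2 k; move: d_ge3; nia.
  have -> : q ^+ (2 * d * k + 1) = q * p ^+ k by rewrite pXE addn1 exprS.
  by rewrite exprVn; ring.
apply: congr_mod_scale; first exact: regular_add1qV.
apply: congr_mod_scale.
  apply: regularM.
    apply: regularM; last exact: regular_qXV.
    apply: regularM; first exact/regularX/regularN/regular1.
    by rewrite pXE; apply: regular_qX.
  by rewrite pXE -exprS; apply: regular_add1qX.
by apply: congr_mod_mul; [apply: r_congr | apply: r_den_congr].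
Qed.

(* If [n] divides [2dk + 1] then [2dk + 1 = n], and [1 - Q] cancels the pole. *)
Lemma pole_regular k : (k <= m)%N -> reg ((1 - Q) / (1 - q * p ^+ k)).
Proof.
move=> km; rewrite pXE -exprS.
case: (boolP (n %| (2 * d * k).+1)%N) => [/dvdnP[c hc]|]; last first.
  move=> nd; apply: regularM; first exact: regular_sub1qX.
  exact: regular_sub1qXV.
have c1 : c = 1%N by move: hc km dm n_gt0; nia.
have -> : (2 * d * k).+1 = n by rewrite hc c1 mul1n.
have -> : (1 - Q) / (1 - q ^+ n) = 1 + q ^+ n.
  have := sub1qX_neq0 n n_gt0; rewrite /Q mulnC exprM => h.
  by field.
exact: regular_add1qX.
Qed.

(** The left-hand side is 1/(1 + q) times the right-hand side of [watson_limit] at b = q; replacing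
    [r k] by (q^2;p)_k^2 undoes the deformation. *)
Lemma rhs_congr :
  cong ((1 + q)^-1 * ((-1) ^+ m * (q ^+ 2) ^+ m * p ^+ 'C(m, 2) * (1 - Q)
    * \sum_(k < m.+1) (p / q ^+ 2) ^+ k * r k
        / ((1 - q * p ^+ k) * qpoch p p k * qpoch (q ^+ 2) p k)))
   ((-1) ^+ m * qint (q ^+ 2) n * ((q ^+ 2) ^+ m * p ^+ 'C(m, 2))
    * rhs_sum F q d m).
Proof.
set u := (-1) ^+ m * (q ^+ 2) ^+ m * p ^+ 'C(m, 2).
have qq : qint (q ^+ 2) n = (1 - Q) / (1 - q ^+ 2).
  apply: (canRL (mulfK _)); first exact: sub1qX_neq0.
  by rewrite /Q exprM /qint -[RHS]opprB subrX1 -[RHS]mulNr opprB mulrC.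
(* [K k] is the undeformed part of the term; 1 - Q is paired with 1 - q p^k so that [pole_regular]
   makes it regular. *)
pose K k : F := (p / q ^+ 2) ^+ k * ((1 + q)^-1 * ((1 - Q) / (1 - q * p ^+ k)))
  * ((qpoch p p k)^-1 * (qpoch (q ^+ 2) p k)^-1).
have -> : (1 + q)^-1 * (u * (1 - Q) * \sum_(k < m.+1) (p / q ^+ 2) ^+ k * r k
        / ((1 - q * p ^+ k) * qpoch p p k * qpoch (q ^+ 2) p k))
    = u * \sum_(k < m.+1) K k * r k.
  rewrite -mulrA mulrCA !mulr_sumr; apply: eq_bigr => k _.
  by rewrite /K !invfM; ring.
have -> : (-1) ^+ m * qint (q ^+ 2) n * ((q ^+ 2) ^+ m * p ^+ 'C(m, 2))
    * rhs_sum F q d m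
    = u * \sum_(k < m.+1) K k * qpoch (q ^+ 2) p k ^+ 2.
  rewrite /rhs_sum big_mkord.
  transitivity (u * (qint (q ^+ 2) n * \sum_(k < m.+1)
    qpochs [:: q ^+ 2; q] (q ^+ (2 * d)) k * q ^+ (2 * (d - 1) * k) /
    qpochs [:: q ^+ (2 * d); q ^+ (2 * d + 1)] (q ^+ (2 * d)) k)).
    by rewrite /u; ring.
  congr (_ * _); rewrite mulr_sumr; apply: eq_bigr => k _.
  rewrite /qpochs !big_cons !big_nil !mulr1 -/p qq /K.
  have -> : q ^+ (2 * (d - 1) * k) = (p / q ^+ 2) ^+ k.
    rewrite exprM; congr (_ ^+ _); apply: (canRL (mulfK _)).
      by rewrite expf_neq0 ?q_neq0.
    by rewrite -exprD; congr (_ ^+ _); move: d_ge3; lia.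
  (* Expanding (q;p)_(k+1) at either end turns (1 - q)/(1 - q p^k) into (q;p)_k / (qp;p)_k. *)
  have := qpochSl F q p k; rewrite qpochS.
  have -> : q * p = q ^+ (2 * d + 1) by rewrite addn1 exprS.
  have h1 : 1 - q * p ^+ k != 0 by rewrite pXE -exprS sub1qX_neq0.
  have h2 : 1 - q != 0 by have := sub1qX_neq0 1 isT.
  have h3 : qpoch (q ^+ (2 * d + 1)) p k != 0.
    apply: qpoch_neq0 => i _; rewrite pXE -exprD sub1qX_neq0 //.
    by rewrite addn1.
  have h4 : qpoch p p k != 0.
    apply: qpoch_neq0 => i _; rewrite -exprS pXE sub1qX_neq0 //.
    by move: d_ge3; lia.
  have h5 : qpoch (q ^+ 2) p k != 0.
    by apply: qpoch_neq0 => i _; rewrite apXE sub1qX_neq0 //; lia.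
  have h6 := add1q_neq0.
  have -> : 1 - q ^+ 2 = (1 - q) * (1 + q) by ring.
  move: h1 h3 h4 h5; set A := qpoch q p k; set B := qpoch (q ^+ (2 * d + 1)) p k.
  set C := qpoch p p k; set D := qpoch (q ^+ 2) p k; set t := p ^+ k.
  move=> h1 h3 h4 h5 hAB.
  have -> : A = (1 - q) * B / (1 - q * t) by rewrite -hAB mulfK.
  by field; rewrite h1 h2 h3 h4 h5 h6.
apply: congr_mod_scale.
  rewrite /u pXE -exprM -mulrA -exprD; apply: regularM; last exact: regular_qX.
  exact/regularX/regularN/regular1.
apply: congr_mod_sum => k _; have km : (k <= m)%N by rewrite -ltnS.
apply: congr_mod_scale; last exact: r_congr.
apply: regularM; last first.
  apply: regularM; last exact: regular_qpoch_aV.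
  by apply: regular_qpoch_pV; move: km dm d_ge3 n_gt0; nia.
apply: regularM.
  apply: regularX; apply: regularM; first exact: regular_qX.
  exact: regular_qXV.
by apply: regularM; [apply: regular_add1qV | apply: pole_regular].
Qed.

Lemma partial_sum_congr :
  cong (\sum_(k < m.+1) c_term F q d k)
   ((-1) ^+ m * qint (q ^+ 2) n * ((q ^+ 2) ^+ m * p ^+ 'C(m, 2))
    * rhs_sum F q d m).
Proof.
apply: congr_mod_trans rhs_congr.
have := watson_limit F q p m; rewrite /= QE => <-.
- rewrite mulr_sumr.
  have sym x y : cong x y -> cong y x.
    move=> [rx ry [s rs e]]; split=> //; exists (- s); first exact: regularN.
    by rewrite mulrN -e opprB.
  by apply: sym; apply: congr_mod_sum => k _; apply: term_congr; rewrite -ltnS.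
- by rewrite expf_neq0 ?q_neq0.
- exact: q_neq0.
- by move=> i; rewrite pXE sub1qX_neq0 //; move: d_ge3; lia.
- by move=> i; rewrite apXE sub1qX_neq0 //; lia.
- by move=> i; rewrite pXE -exprS sub1qX_neq0.
- by move=> i; rewrite pXE sub1qXdivQ_neq0 ?p_neq_Q.
Qed.

(** * From the single sum to the triple sum *)

Lemma triple_sum_congr :
  cong (\sum_(i < n) \sum_(j < n) \sum_(s < n | (i + j + s <= n - 1)%N)
          c_term F q d i * c_term F q d j * c_term F q d s)
    ((\sum_(k < m.+1) c_term F q d k) ^+ 3).
Proof.
(* Truncating to zero beyond [m] lets the cube and the triple sum run over the same range ['I_n]. *)
pose c0 k := if (k <= m)%N then c_term F q d k else 0.
have cc0 (k : 'I_n) : cong (c_term F q d k) (c0 k).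
  rewrite /c0; case: (leqP k m) => h; last by apply: c_term_congr0; rewrite h /=.
  exact/congr_mod_refl/regular_c_term.
have mn : (m.+1 <= n)%N by move: leq_3m n_gt0; lia.
have -> : \sum_(k < m.+1) c_term F q d k = \sum_(k < n) c0 k.
  rewrite (big_ord_widen _ (fun k => c_term F q d k) mn) big_mkcond /=.
  by apply: eq_bigr => k _; rewrite /c0 ltnS.
have -> : (\sum_(k < n) c0 k) ^+ 3
    = \sum_(i < n) \sum_(j < n) \sum_(s < n | (i + j + s <= n - 1)%N)
        c0 i * c0 j * c0 s.
  rewrite !exprS expr0 mulr1 mulr_suml; apply: eq_bigr => i _.
  rewrite mulrA [c0 i * \sum_(_ < _) _]mulr_sumr mulr_suml; apply: eq_bigr => j _.
  rewrite mulr_sumr [RHS]big_mkcond; apply: eq_bigr => s _.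
  (* A triple excluded from the sum has an index above [m], since otherwise i + j + s <= 3m <= n -
     1; its product is then 0. *)
  case: ifPn => //; rewrite -ltnNge /c0 => h.
  case: (leqP i m) => im; last by rewrite !mul0r.
  case: (leqP j m) => jm; last by rewrite mulr0 mul0r.
  case: (leqP s m) => sm; last by rewrite mulr0.
  by move: leq_3m h; lia.
do 3 (apply: congr_mod_sum => ? _).
by do 2 (apply: congr_mod_mul => //).
Qed.

Lemma triple_sum_congr_rhs :
  cong (\sum_(i < n) \sum_(j < n) \sum_(s < n | (i + j + s <= n - 1)%N)
          c_term F q d i * c_term F q d j * c_term F q d s)
    ((-1) ^+ (3 * m) * qint (q ^+ 2) n ^+ 3
     * q ^ ((3 * m)%:Z * (n%:Z + 1 - d%:Z)) * rhs_sum F q d m ^+ 3).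
Proof.
apply: congr_mod_trans triple_sum_congr _.
have := congr_mod_exp _ _ _ _ _ 3 partial_sum_congr.
congr (congr_mod _ _ _ _ _).
(* As n = dm + 1, m(n + 1 - d) = 2m + dm(m - 1) is nonnegative, so the integer power is a natural
   one. *)
have -> : (3 * m)%:Z * (n%:Z + 1 - d%:Z) = (3 * (2 * m + 2 * d * 'C(m, 2)))%N.
  case: (m) dm => [|l] dl; first by rewrite !muln0 mul0r.
  by have := double_bin2 l; move: dl n_gt0; nia.
have e : q ^+ (2 * m + 2 * d * 'C(m, 2)) = (q ^+ 2) ^+ m * p ^+ 'C(m, 2).
  by rewrite exprD /p !exprM.
by rewrite -exprnP !(mulnC 3) exprM [q ^+ (_ * 3)%N]exprM e !exprMn.
Qed.

End Cyclotomic.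

(** For n = 1 each sum has a single term and both sides are 1, so equality replaces the regularity
    argument. *)
Lemma triple_sum_n1 (F : fieldType) (q : F) (d : nat) : 1 + q != 0 ->
  \sum_(i < 1) \sum_(j < 1) \sum_(s < 1 | (i + j + s <= 1 - 1)%N)
     c_term F q d i * c_term F q d j * c_term F q d s
  = (-1) ^+ (3 * 0) * qint (q ^+ 2) 1 ^+ 3
    * q ^ ((3 * 0)%:Z * (1%:Z + 1 - d%:Z)) * rhs_sum F q d 0 ^+ 3.
Proof.
move=> q1.
have c0 : c_term F q d 0 = 1.
  rewrite /c_term !qpoch0 !muln0 !expr0 expr1 mul1r !mulr1.
  by rewrite expr1n mulr1 divff // mulr1.
have r0 : rhs_sum F q d 0 = 1.
  rewrite /rhs_sum big_nat1 /qpochs !big_cons !big_nil !qpoch0 muln0 expr0.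
  by rewrite !mulr1 divr1.
rewrite r0 muln0 mul0r expr0z /qint !big_ord1 big_mkcond big_ord1 /= c0.
by rewrite !expr0 !expr1n !mulr1.
Qed.

Lemma qcongr_refl (P : {poly rat}) (x : ratfun) : qcongr P x x.
Proof.
exists 0, 1; split; first exact: oner_neq0.
- by rewrite coprimep1.
- by rewrite subrr tofrac0 mul0r.
- exact: dvdp0.
- by rewrite coprime1p.
Qed.

Theorem theorem5p2 (n d : nat) (n_gt0 : (0 < n)%N) (n_odd : odd n)
    (d_ge3 : (3 <= d)%N) (n_mod_d : n = 1 %[mod d]) :
  let q := qvar in
  let m := ((n - 1) %/ d)%N in
  qcongr ((Phi n \Po (- 'X)) ^+ 2 * Phi n ^+ 2)
    (\sum_(i < n) \sum_(j < n) \sum_(s < n | (i + j + s <= n - 1)%N)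
        c_q d i * c_q d j * c_q d s)
    ((-1) ^+ (3 * m) * qint (q ^+ 2) n ^+ 3
     * q ^ ((3 * m)%:Z * (n%:Z + 1 - d%:Z))
     * (\sum_(0 <= k < m.+1)
          qpochs [:: q ^+ 2; q] (q ^+ (2 * d)) k * q ^+ (2 * (d - 1) * k)
          / qpochs [:: q ^+ (2 * d); q ^+ (2 * d + 1)] (q ^+ (2 * d)) k) ^+ 3).
Proof.
move=> q m.
have dn : (d %| n - 1)%N by rewrite -eqn_mod_dvd //; apply/eqP.
have dm : (d * m = n - 1)%N by rewrite mulnC divnK.
have f_inj : injective (@FracField.tofrac {poly rat}).
  by move=> x y /eqP; rewrite tofrac_eq => /eqP.
case: (ltnP 1 n) => n1.
  apply: congr_mod_qcongr.
  exact: (triple_sum_congr_rhs ratfun _ qvar n f_inj erefl n1 n_odd d m d_ge3 dm).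
have e1 : n = 1%N by apply/eqP; rewrite eqn_leq n1 n_gt0.
have m0 : m = 0%N by rewrite /m e1 div0n.
have q1 : 1 + q != 0 := add1q_neq0 ratfun _ qvar f_inj erefl.
have := triple_sum_n1 ratfun q d q1.
rewrite m0; clearbody m; subst n => e.
exact: (eq_ind_r (fun z => qcongr _ z _) (qcongr_refl _ _) e).
Qed.
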